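(* Let $p$ be an odd prime, let $(G,T)$ be a group of $GM(p)$-type, let $\mathbb{F}$ be a field and $\eta\in\mathbb{F}$ such that $\mathbb{F}$ has good characteristic relative to $(p,\eta)$, and let $A=A_{\mathbb{F}}(G,T,\eta)$. Let $(\cdot,\cdot)$ be the symmetric bilinear form on $A$ determined by $(a,a)=1$ for $a\in T$ and $(a,b)=\eta$ for any distinct $a,b\in T$. If $\eta=-\frac{1}{p-2}$, then $(\cdot,\cdot)$ is a left Frobenius form.
   Context: Groups. A pair $(G,T)$ is a faithful odd transposition group if $G$ is a periodic group, $T$ is a normal (conjugation-invariant) subset of involutions of $G$ with $\langle T\rangle=G$, and $|ab|$ is odd for any $a,b\in T$. It is of $GM(p)$-type if $|ab|=p$ for any two distinct $a,b\in T$. Write $a^b=b^{-1}ab$, and let $I(a,b)$ be the set of all involutions of $\langle a,b\rangle$. Algebra. Fields have characteristic not $2$; algebras are not assumed associative or commutative. $A_{\mathbb{F}}(G,T,\eta)$ (for $\eta\in\mathbb{F}\setminus\{0,1\}$) is the $\mathbb{F}$-algebra with basis $T$ and bilinear product $a*a=a$, and $a*b=b^a+\eta\sum_{x\in I(a,b)\setminus\{b^a\}}x$ for $a\ne b$ in $T$. The field has good characteristic relative to $(p,\eta)$ if $1,\ \eta(p-2)+1,\ \eta-1,\ 1-\eta$ are distinct in $\mathbb{F}$. A bilinear form $(\cdot,\cdot)$ on an algebra $A$ is a left Frobenius form if $(x*y,z)=(y,x*z)$ for all $x,y,z\in A$. *)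

(* Defs.v *)
From HB Require Import structures.
From mathcomp Require Import all_boot all_order all_algebra.
From mathcomp Require Import finmap.
From mathcomp Require Import boolp classical_sets cardinality fsbigop.
From mathcomp Require Import monalg.

Set Implicit Arguments.
Unset Strict Implicit.
Unset Printing Implicit Defensive.

Import GRing.Theory.

Local Open Scope classical_set_scope.
Local Open Scope ring_scope.

Section Groups.
Local Open Scope group_scope.
Context {G : groupType}.
Implicit Types (x y a b r g : G) (S T : set G).

(* The order operator of the library is restricted to finite groups. *)
Definition has_order x (n : nat) : Prop :=
  [/\ (0 < n)%N, x ^+ n = 1 & forall m, (0 < m < n)%N -> x ^+ m <> 1].

Definition involutions : set G := [set x | has_order x 2].

Definition generated S : set G :=
  smallest [set H : set G | group_closed (mem H)] S.

Definition invol_in a b : set G := generated [set a; b] `&` involutions.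

Record odd_transposition_group T : Prop := OddTranspositionGroup {
  otg_periodic : forall x, exists n, has_order x n;
  otg_involutions : T `<=` involutions;
  otg_normal : forall x g, T x -> T (x ^ g);
  otg_generated : generated T = [set: G];
  otg_odd : forall a b, T a -> T b -> exists2 n, odd n & has_order (a * b) n
}.

Record GM_type (p : nat) T : Prop := GMType {
  GM_otg : odd_transposition_group T;
  GM_order : forall a b, T a -> T b -> a <> b -> has_order (a * b) p
}.

Section InvolutionsInDihedral.
Variables (a b : G) (n : nat).
Hypotheses (inva : has_order a 2) (invb : has_order b 2).
Hypotheses (oddn : odd n) (ordr : has_order (a * b) n).

Let r := a * b.

Let a2 : a * a = 1. Proof. by case: inva => _; rewrite expg2. Qed.
Let b2 : b * b = 1. Proof. by case: invb => _; rewrite expg2. Qed.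
Let aV : a^-1 = a. Proof. by rewrite -[LHS]mulg1 -a2 mulKg. Qed.
Let bV : b^-1 = b. Proof. by rewrite -[LHS]mulg1 -b2 mulKg. Qed.
Let n_gt0 : (0 < n)%N. Proof. by case: ordr. Qed.
Let rn : r ^+ n = 1. Proof. by case: ordr. Qed.
Let rX k : (r ^+ k) ^+ n = 1.
Proof. by rewrite expgnAC rn expg1n. Qed.

Let rV k : (r ^+ k)^-1 = r ^+ (n.-1 * k).
Proof.
apply: (@mulgI _ (r ^+ k)).
by rewrite mulgV -expgnDr -mulSn prednK // expgnA rn expg1n.
Qed.

Let ra k : a * r ^+ k = (r ^+ k)^-1 * a.
Proof.
have -> : (r ^+ k)^-1 = (r ^+ k) ^ a.
  rewrite conjXg -expVgn; congr (_ ^+ _).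
  by rewrite /r invgM conjgE aV bV !mulgA a2 mul1g.
by rewrite conjgE aV -!mulgA a2 mulg1.
Qed.

Let dihedral : set G := [set g | exists k, g = r ^+ k \/ g = r ^+ k * a].

Let dihedral_sub : generated [set a; b] `<=` dihedral.
Proof.
apply: smallest_sub; last first.
  move=> _ [->|->]; first by exists 0%N; right; rewrite expg0 mul1g.
  exists n.-1; right; rewrite -[n.-1]muln1 -rV expg1 /r invgM aV bV.
  by rewrite -mulgA a2 mulg1.
split; first by rewrite inE; exists 0%N; left.
move=> u v; rewrite !inE => -[k [->|->]] [l [->|->]].
- by exists (k + n.-1 * l)%N; left; rewrite expgnDr -rV.
- by exists (k + l)%N; right; rewrite invgM aV rV ra -rV invgK expgnDr mulgA.
- exists (k + l)%N; right.
  by rewrite -mulgA rV ra -rV invgK mulgA expgnDr.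
- exists (k + n.-1 * l)%N; left.
  by rewrite invgM aV -mulgA [a * _]mulgA a2 mul1g rV expgnDr.
Qed.

Lemma invol_in_conj x : invol_in a b x -> exists g, x = a ^ g.
Proof.
case=> /dihedral_sub[k [->|->]].
  case=> _ rk2 /(_ 1%N isT) []; rewrite expg1.
  by have := rX k; rewrite -[n]odd_double_half oddn -mul2n expgnDr expgnA rk2
    expg1n mulg1.
move=> _; exists (r ^+ (n./2 * k)); rewrite conjgE ra mulgA -invgM -expgnDr.
rewrite -mulnDl addnn; have -> : (n./2.*2 = n.-1)%N.
  by rewrite -[in RHS](odd_double_half n) oddn.
by rewrite -rV invgK.
Qed.

Lemma finite_invol_in : finite_set (invol_in a b).
Proof.
apply: (@sub_finite_set _ _
  ([set r ^+ k | k in `I_n] `|` [set r ^+ k * a | k in `I_n])).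
  move=> x [/dihedral_sub[k xk] _].
  have rk : r ^+ k = r ^+ (k %% n).
    by rewrite {1}(divn_eq k n) expgnDr mulnC expgnA rn expg1n mul1g.
  by case: xk => ->; [left|right]; exists (k %% n)%N; rewrite /= ?ltn_mod -?rk.
by rewrite finite_setU; split; apply: finite_image; apply: finite_II.
Qed.

End InvolutionsInDihedral.

Context {T : set G} (oT : odd_transposition_group T).

(* These two facts make the finitely supported sum over the x : T lying in
   I(a, b), used in otg_basis_mul, the sum over all of I(a, b). *)
Lemma invol_in_sub a b : T a -> T b -> invol_in a b `<=` T.
Proof.
move=> Ta Tb x; have [n oddn ordn] := otg_odd oT Ta Tb.
have [ia ib] := (otg_involutions oT Ta, otg_involutions oT Tb).
by case/(invol_in_conj ia ib oddn ordn) => g ->; apply: otg_normal.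
Qed.

Lemma otg_finite_invol_in a b : T a -> T b -> finite_set (invol_in a b).
Proof.
move=> Ta Tb; have [n _ ordn] := otg_odd oT Ta Tb.
have [ia ib] := (otg_involutions oT Ta, otg_involutions oT Tb).
exact: finite_invol_in ia ib ordn.
Qed.

Lemma conjT_subproof (b a : T) : \val b ^ \val a \in T.
Proof. by rewrite inE; apply: (otg_normal oT); apply: set_valP. Qed.

Definition conjT (b a : T) : T := Sub (\val b ^ \val a) (conjT_subproof b a).

End Groups.

Section BilinearExtension.
Context {F : fieldType} {K : choiceType}.

Section Vector.
Context {V : lmodType F} (h : K -> K -> V).

Definition bilin_ext (u v : {malg F[K]}) : V :=
  \sum_(a <- msupp u) \sum_(b <- msupp v) (u@_a * v@_b) *: h a b.

Lemma bilin_extw (d1 d2 : {fset K}) u v :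
    (msupp u `<=` d1)%fset -> (msupp v `<=` d2)%fset ->
  bilin_ext u v = \sum_(a <- d1) \sum_(b <- d2) (u@_a * v@_b) *: h a b.
Proof.
move=> s1 s2; rewrite /bilin_ext (big_fset_incl _ s1) /=; last first.
  by move=> a _ /mcoeff_outdom->; rewrite big1 // => b _; rewrite mul0r scale0r.
apply: eq_bigr => a _; apply: big_fset_incl => // b _ /mcoeff_outdom->.
by rewrite mulr0 scale0r.
Qed.

Lemma bilin_extUU a b : bilin_ext << a >> << b >> = h a b.
Proof.
rewrite (bilin_extw (msuppU_le) (msuppU_le)) !big_seq_fset1 !mcoeffUU.
by rewrite mulr1 scale1r.
Qed.

Lemma bilin_ext_linearl v : linear (bilin_ext^~ v).
Proof.
move=> c u w.
pose d := (msupp (c *: u + w) `|` (msupp u `|` msupp w))%fset.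
have s0 : (msupp (c *: u + w) `<=` d)%fset by apply: fsubsetUl.
have s1 : (msupp u `<=` d)%fset.
  exact: fsubset_trans (fsubsetUl _ _) (fsubsetUr _ _).
have s2 : (msupp w `<=` d)%fset.
  exact: fsubset_trans (fsubsetUr _ _) (fsubsetUr _ _).
have sv := fsubset_refl (msupp v).
rewrite (bilin_extw s0 sv) (bilin_extw s1 sv) (bilin_extw s2 sv).
rewrite scaler_sumr -big_split; apply: eq_bigr => a _ /=.
rewrite scaler_sumr -big_split; apply: eq_bigr => b _ /=.
by rewrite mcoeffD mcoeffZ mulrDl scalerDl -mulrA scalerA.
Qed.

Lemma bilin_ext_linearr u : linear (bilin_ext u).
Proof.
move=> c v w.
pose d := (msupp (c *: v + w) `|` (msupp v `|` msupp w))%fset.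
have s0 : (msupp (c *: v + w) `<=` d)%fset by apply: fsubsetUl.
have s1 : (msupp v `<=` d)%fset.
  exact: fsubset_trans (fsubsetUl _ _) (fsubsetUr _ _).
have s2 : (msupp w `<=` d)%fset.
  exact: fsubset_trans (fsubsetUr _ _) (fsubsetUr _ _).
have su := fsubset_refl (msupp u).
rewrite (bilin_extw su s0) (bilin_extw su s1) (bilin_extw su s2).
rewrite scaler_sumr -big_split; apply: eq_bigr => a _ /=.
rewrite scaler_sumr -big_split; apply: eq_bigr => b _ /=.
by rewrite mcoeffD mcoeffZ mulrDr scalerDl mulrCA scalerA.
Qed.

HB.instance Definition _ := bilinear_isBilinear.Build F {malg F[K]} {malg F[K]}
  V *:%R *:%R bilin_ext (bilin_ext_linearl, bilin_ext_linearr).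

End Vector.

Definition biscalar_ext (h : K -> K -> F) : {malg F[K]} -> {malg F[K]} -> F :=
  bilin_ext (h : K -> K -> F^o).

HB.instance Definition _ (h : K -> K -> F) :=
  bilinear_isBilinear.Build F {malg F[K]} {malg F[K]} F *%R *%R (biscalar_ext h)
    (bilin_ext_linearl (h : K -> K -> F^o), bilin_ext_linearr (h : K -> K -> F^o)).

End BilinearExtension.

Section Algebra.
Context {G : groupType} {T : set G} {F : fieldType}.

Definition otg_basis_mul (oT : odd_transposition_group T) (eta : F) (a b : T) :
    {malg F[T]} :=
  if a == b then << a >>
  else << conjT oT b a >>
       + eta *: \sum_(x \in [set x : T | invol_in (\val a) (\val b) (\val x)]
                              `\ conjT oT b a) (<< x >> : {malg F[T]}).

(* The algebra A_F(G, T, eta) is the free F-module {malg F[T]} on T together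
   with this product (T is not a monomType, so {malg F[T]} carries no ring
   product of its own). *)
Definition otg_mul (oT : odd_transposition_group T) (eta : F) :
    {bilinear {malg F[T]} -> {malg F[T]} -> {malg F[T]}} :=
  bilin_ext (otg_basis_mul oT eta).

Definition GM_form (T : set G) (eta : F) : {biscalar {malg F[T]}} :=
  biscalar_ext (fun a b : T => if a == b then 1 else eta).

Lemma GM_formxx (eta : F) (a : T) : GM_form T eta << a >> << a >> = 1.
Proof. by rewrite /GM_form /= /biscalar_ext bilin_extUU eqxx. Qed.

Lemma GM_formxy (eta : F) (a b : T) :
  a != b -> GM_form T eta << a >> << b >> = eta.
Proof.
by move=> /negPf ab; rewrite /GM_form /= /biscalar_ext bilin_extUU ab.
Qed.

Lemma GM_form_sym (eta : F) (u v : {malg F[T]}) :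
  GM_form T eta u v = GM_form T eta v u.
Proof.
rewrite /GM_form /= /biscalar_ext /bilin_ext exchange_big; apply: eq_bigr => a _.
by apply: eq_bigr => b _; rewrite mulrC eq_sym.
Qed.

End Algebra.

Definition left_frobenius (F : fieldType) (A : lmodType F)
    (mul : {bilinear A -> A -> A}) (form : {biscalar A}) : Prop :=
  forall x y z, form (mul x y) z = form y (mul x z).

Definition good_characteristic (F : fieldType) (p : nat) (eta : F) : bool :=
  uniq [:: 1; eta * (p%:R - 2%:R) + 1; eta - 1; 1 - eta].

(* Main.v *)
Require Import Defs.
From HB Require Import structures.
From mathcomp Require Import all_boot all_order all_algebra.
From mathcomp Require Import finmap.
From mathcomp Require Import ring.
From mathcomp Require Import classical_sets functions cardinality fsbigop.
From mathcomp Require Import monalg.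

(** The identity (x * y, z) = (y, x * z) is trilinear, so it is enough to check
it for x = a, y = b, z = c in T (left_frobenius_basis).

Write the form on T as (x, c) = eta + (1 - eta) [x = c], where [P] is 1 if P
holds and 0 otherwise.  Thus (u, c) is eta times the sum of the coordinates
of u, plus 1 - eta times its coordinate at c.  For a <> b the product is
a * b = (1 - eta) b^a + eta (sum of I(a, b)), and I(a, b), the set of
reflections of a dihedral group of order 2p, has p elements (card_invol_in).
So the coordinates of a * b sum to 1 + eta (p - 1), which is equal to eta
exactly when eta (p - 2) = -1.  This gives, for a <> b (GM_form_mul),

   (a * b, c) = eta^2 + (1 - eta) ((1 - eta) [b^a = c] + eta [c in I(a, b)]).

If a differs from both b and c, this expression is symmetric in b and c:
conjugation by a is an involution (conjT_swap), and since p is prime any c <> a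
in I(a, b) generates with a the same dihedral group as b does, so that c lies
in I(a, b) if and only if b lies in I(a, c) (invol_in_exchange).

If a = b <> c, the two sides are (a, c) = eta and (a * c, a) by symmetry of the
form.  The formula evaluates the latter to eta^2 + (1 - eta) eta = eta, as a
lies in I(a, c) and c^a <> a.  The case a = c <> b is the same. *)

Set Implicit Arguments.
Unset Strict Implicit.
Unset Printing Implicit Defensive.

Import GRing.Theory.
Local Open Scope ring_scope.

(** * The dihedral group generated by two involutions *)

Section TwoInvolutions.
Local Open Scope group_scope.
Local Open Scope classical_set_scope.

Lemma order2_mulgg (G : groupType) (a : G) : has_order a 2 -> a * a = 1.
Proof. by case=> _; rewrite expg2. Qed.

Lemma order2_inv (G : groupType) (a : G) : has_order a 2 -> a^-1 = a.
Proof. by move/order2_mulgg => a2; rewrite -[LHS]mulg1 -a2 mulKg. Qed.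

Lemma conj_involutions (G : groupType) (a g : G) :
  involutions a -> involutions (a ^ g).
Proof.
move=> [_ a2 a1]; split=> // [|m m2]; first by rewrite -conjXg a2 conj1g.
by rewrite -conjXg => /(congr1 (conjg^~ g^-1)); rewrite conjgK conj1g; apply: a1.
Qed.

Lemma generated_group (G : groupType) (S : set G) :
  S `<=` generated S /\ group_closed (mem (generated S)).
Proof.
split; first exact: sub_gen_smallest.
split; first by rewrite inE => H [[H1 _] _]; rewrite inE in H1.
move=> u v; rewrite !inE => Su Sv H HS; have [[_ HV] _] := HS.
by have := HV u v; rewrite !inE; apply; [apply: Su | apply: Sv].
Qed.

Lemma generatedM (G : groupType) (S : set G) (x y : G) :
  generated S x -> generated S y -> generated S (x * y).
Proof.
have [_ /group_closedM SM] := generated_group S.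
by move=> Sx Sy; have := SM x y; rewrite !inE; apply.
Qed.

Lemma generatedX (G : groupType) (S : set G) (x : G) n :
  generated S x -> generated S (x ^+ n).
Proof.
have [_ [S1 _]] := generated_group S; rewrite inE in S1.
by move=> Sx; elim: n => [//|n IHn]; rewrite expgS; apply: generatedM.
Qed.

Lemma has_order_inj (G : groupType) (r : G) n k l : has_order r n ->
  (k < n)%N -> (l < n)%N -> r ^+ k = r ^+ l -> k = l.
Proof.
move=> [n_gt0 rn r1]; wlog kl : k l / (k <= l)%N => [wl kn ln rkl|kn ln rkl].
  by case: (leqP k l) => [|/ltnW] h; [apply: wl | apply/esym/wl].
apply/eqP; rewrite eqn_leq kl /= -subn_eq0 -leqn0 leqNgt; apply/negP => kl0.
apply: (r1 (l - k)%N); first by rewrite kl0 (leq_ltn_trans (leq_subr _ _)).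
by apply: (@mulIg _ (r ^+ k)); rewrite -expgnDr subnK // mul1g.
Qed.

Lemma expg_invE (G : groupType) (r : G) n k : (0 < n)%N -> r ^+ n = 1 ->
  (r ^+ k)^-1 = r ^+ (n.-1 * k).
Proof.
move=> n_gt0 rn; apply: (@mulgI _ (r ^+ k)).
by rewrite mulgV -expgnDr -mulSn prednK // expgnA rn expg1n.
Qed.

Lemma reflection_rotation (G : groupType) (a b : G) k :
    has_order a 2 -> has_order b 2 ->
  a * (a * b) ^+ k = ((a * b) ^+ k)^-1 * a.
Proof.
move=> ia ib; have [[a2 aV] bV] := (order2_mulgg ia, order2_inv ia, order2_inv ib).
have -> : ((a * b) ^+ k)^-1 = ((a * b) ^+ k) ^ a.
  rewrite conjXg -expVgn; congr (_ ^+ _).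
  by rewrite invgM conjgE aV bV !mulgA a2 mul1g.
by rewrite conjgE aV -!mulgA a2 mulg1.
Qed.

(** With r = ab, a ^ (r^m) = r^(-2m) a.  For m = (n./2) k the exponent -2m is
k modulo n, because 2 (n./2) = n - 1 for n odd. *)
Lemma reflection_conj (G : groupType) (a b : G) n k :
    has_order a 2 -> has_order b 2 -> odd n -> (a * b) ^+ n = 1 ->
  (a * b) ^+ k * a = a ^ ((a * b) ^+ (n./2 * k)).
Proof.
move=> ia ib oddn rn; rewrite conjgE reflection_rotation // mulgA -invgM.
have n2 : (n./2.*2 = n.-1)%N by rewrite -[in RHS](odd_double_half n) oddn.
rewrite -expgnDr -mulnDl addnn n2 -(expg_invE _ _ rn) ?invgK //.
by case: (n) oddn.
Qed.

(** A rotation is never an involution, because its order divides the odd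
number n; a reflection always is one, being conjugate to a. *)
Lemma invol_inE (G : groupType) (a b : G) n :
    has_order a 2 -> has_order b 2 -> odd n -> has_order (a * b) n ->
  invol_in a b = [set (a * b) ^+ k * a | k in `I_n].
Proof.
move=> ia ib oddn [n_gt0 rn _]; set r := a * b in rn *.
have [[a2 aV] bV] := (order2_mulgg ia, order2_inv ia, order2_inv ib).
have rmod k : exists2 l, (l < n)%N & r ^+ l = r ^+ k.
  exists (k %% n)%N; first by rewrite ltn_mod.
  by rewrite [in RHS](divn_eq k n) expgnDr mulnC expgnA rn expg1n mul1g.
apply/seteqP; split=> [x [gx ix]|_ [k _ <-]].
  have rV k := expg_invE k n_gt0 rn.
  have ra k := reflection_rotation k ia ib.
  (* The rotations and reflections form a subgroup containing a and b, which
     therefore contains the generated one. *)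
  pose D : set G := [set g | exists k, g = r ^+ k \/ g = r ^+ k * a].
  have : D x.
    apply: gx; split; last first.
      move=> _ [->|->]; first by exists 0%N; right; rewrite mul1g.
      exists n.-1; right; rewrite -[n.-1]muln1 -rV expg1 /r invgM aV bV.
      by rewrite -mulgA a2 mulg1.
    split; first by rewrite inE; exists 0%N; left.
    move=> u v; rewrite !inE => -[k [->|->]] [l [->|->]].
    - by exists (k + n.-1 * l)%N; left; rewrite expgnDr -rV.
    - by exists (k + l)%N; right; rewrite invgM aV rV ra -rV invgK expgnDr mulgA.
    - by exists (k + l)%N; right; rewrite -mulgA rV ra -rV invgK mulgA expgnDr.
    - exists (k + n.-1 * l)%N; left.
      by rewrite invgM aV -mulgA [a * _]mulgA a2 mul1g rV expgnDr.
  case=> k [] xk; last by have [l ln rl] := rmod k; exists l => //; rewrite rl.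
  case: ix => _ x2 /(_ 1%N isT) []; rewrite expg1.
  have xn : x ^+ n = 1 by rewrite xk expgnAC rn expg1n.
  by move: xn; rewrite -[n]odd_double_half oddn -mul2n expgnDr expgnA x2
    expg1n mulg1.
split; last first.
  rewrite (reflection_conj k ia ib oddn rn).
  exact: conj_involutions.
have [sub _] := generated_group [set a; b].
apply: generatedM; last by apply: sub; left.
by apply: generatedX; apply: generatedM; apply: sub; [left|right].
Qed.

Lemma invol_in_left (G : groupType) (a b : G) :
  has_order a 2 -> invol_in a b a.
Proof. by split=> //; apply: sub_gen_smallest; left. Qed.

Lemma conj_invol_in (G : groupType) (a b : G) :
  has_order a 2 -> has_order b 2 -> invol_in a b (b ^ a).
Proof.
move=> ia ib; have aV := order2_inv ia.
have [sub _] := generated_group [set a; b].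
split; last exact: conj_involutions.
rewrite conjgE aV; apply: generatedM; first by apply: sub; left.
by apply: generatedM; apply: sub; [right|left].
Qed.

Lemma card_invol_in (G : groupType) (a b : G) n :
    has_order a 2 -> has_order b 2 -> odd n -> has_order (a * b) n ->
  (invol_in a b #= `I_n)%card.
Proof.
move=> ia ib oddn ordr; rewrite (invol_inE ia ib oddn ordr).
apply: inj_card_eq => k l; rewrite !inE => kn ln /mulIg.
exact: has_order_inj ordr kn ln.
Qed.

(** Write c = (ab)^k a with k prime to p, and let m be an inverse of k modulo p:
then (ca)^m = (ab)^(km) = ab, which recovers b inside the group generated by
a and c. *)
Lemma invol_in_exchange (G : groupType) (a b c : G) p : prime p -> odd p ->
    has_order a 2 -> has_order b 2 -> has_order (a * b) p ->
  c <> a -> invol_in a b c -> invol_in a c b.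
Proof.
move=> pr_p odd_p ia ib ordr ca.
rewrite (invol_inE ia ib odd_p ordr) => -[k kp ck].
have [a2 [_ rp _]] := (order2_mulgg ia, ordr).
split=> //; have [sub _] := generated_group [set a; c].
have [Sa Sc] : generated [set a; c] a /\ generated [set a; c] c.
  by split; apply: sub; [left|right].
have k_gt0 : (0 < k)%N.
  by rewrite lt0n; apply/eqP => k0; apply: ca; rewrite -ck k0 mul1g.
have /(coprimeP _ k_gt0)[[m q] /= km] : coprime k p.
  by rewrite coprime_sym prime_coprime // gtnNdvd.
have {}km : (k * m = q * p + 1)%N by rewrite -km mulnC subnKC // ltnW // -subn_gt0 km.
have <- : a * (c * a) ^+ m = b.
  rewrite -ck -mulgA a2 mulg1 -expgnA km.
  by rewrite expgnDr mulnC expgnA rp expg1n mul1g mulgA a2 mul1g.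
by apply: generatedM => //; apply: generatedX; apply: generatedM.
Qed.

End TwoInvolutions.

(** * Products and values of the form on basis elements *)

Section Algebra.
Context {G : groupType} {T : set G} {F : fieldType}.
Implicit Types (a b c x : T) (eta : F).

(** Splitting off the constant eta turns the form into a multiple of the sum of
coordinates plus a multiple of one coordinate. *)
Lemma GM_formE eta a b :
  GM_form T eta << a >> << b >> = eta + (1 - eta) * (a == b)%:R.
Proof.
case: (eqVneq a b) => [<-|ab]; first by rewrite GM_formxx mulr1 addrC subrK.
by rewrite GM_formxy // mulr0 addr0.
Qed.

Lemma GM_form_sum eta (X : {fset T}) c :
  GM_form T eta (\sum_(x <- X) << x >>) << c >>
    = eta * #|` X|%:R + (1 - eta) * (c \in X)%:R.
Proof.
rewrite linear_sumlz (eq_bigr _ (fun x _ => GM_formE eta x c)) big_split /=.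
rewrite -mulr_sumr big_const_seq count_predT iter_addr_0 mulr_natr.
congr (_ + _ * _); case: (boolP (c \in X)) => [cX|cX].
  by rewrite (bigD1_seq c) ?fset_uniq // eqxx big1 /= ?addr0 // => x /negPf ->.
by rewrite big1_seq // => x /= xX; case: eqVneq cX => // <-; rewrite xX.
Qed.

Lemma conjTE (oT : odd_transposition_group T) b a :
  \val (conjT oT b a) = (\val b ^ \val a)%g.
Proof. by []. Qed.

Lemma conjTxx (oT : odd_transposition_group T) a : conjT oT a a = a.
Proof. by apply: val_inj; rewrite conjTE conjgE mulKg. Qed.

Lemma conjT_swap (oT : odd_transposition_group T) a b c :
  (conjT oT b a == c) = (conjT oT c a == b).
Proof.
have aV : ((\val a)^-1 = \val a)%g.
  by apply/order2_inv/(otg_involutions oT)/set_valP.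
have K x : conjT oT (conjT oT x a) a = x.
  by apply: val_inj; rewrite !conjTE -{2}aV conjgK.
by apply/eqP/eqP => <-.
Qed.

(** The set I(a, b) as a set of basis indices: it lives in the subtype T, and no
involution is lost by that restriction (val_involT). *)
Definition involT a b : set T := [set x | invol_in (\val a) (\val b) (\val x)].

Lemma val_involT (oT : odd_transposition_group T) a b :
  ((\val : T -> G) @` involT a b = invol_in (\val a) (\val b))%classic.
Proof.
apply/seteqP; split=> [_ [x xI <-] //|x xI].
have Tx := invol_in_sub oT (set_valP a) (set_valP b) xI.
by exists (SigSub (mem_set Tx)).
Qed.

Lemma finite_involT (oT : odd_transposition_group T) a b :
  finite_set (involT a b).
Proof.
apply: (@finite_preimage _ _ (invol_in (\val a) (\val b)) \val).
  by move=> x y _ _; apply: val_inj.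
by apply: (otg_finite_invol_in oT); apply: set_valP.
Qed.

Lemma card_involT p (GMT : GM_type p T) a b : odd p -> a != b ->
  #|` fset_set (involT a b)| = p.
Proof.
move=> odd_p ab; apply: card_fset_set.
have inv x : has_order (\val x) 2 := otg_involutions (GM_otg GMT) (set_valP x).
have := card_invol_in (inv a) (inv b) odd_p.
rewrite -(val_involT (GM_otg GMT)).
rewrite (card_eql (inj_card_eq _)); last by move=> x y _ _; apply: val_inj.
apply; apply: (GM_order GMT); [exact: set_valP|exact: set_valP|].
by apply/eqP; rewrite val_eqE.
Qed.

(** Since b^a itself lies in I(a, b), adding and subtracting eta b^a makes the
sum run over all of I(a, b), whose size is known. *)
Lemma otg_basis_mul_neq (oT : odd_transposition_group T) eta a b : a != b ->
  otg_basis_mul oT eta a b = (1 - eta) *: << conjT oT b a >>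
    + eta *: \sum_(x <- fset_set (involT a b)) << x >>.
Proof.
move=> ab; rewrite /otg_basis_mul (negPf ab).
rewrite -fsbig_finite; last exact: finite_involT.
rewrite (fsbigD1 (conjT oT b a)) /=; [|exact: finite_involT|].
  by rewrite scalerDr addrA -scalerDl subrK scale1r.
by apply: conj_invol_in; apply/(otg_involutions oT)/set_valP.
Qed.

End Algebra.

(** * The left Frobenius identity *)

Lemma malg_scalar_ext (F : fieldType) (K : choiceType)
    (f g : {malg F[K]} -> F) : scalar f -> scalar g ->
  (forall k, f << k >> = g << k >>) -> f =1 g.
Proof.
move=> lf lg fg u.
pose fL := GRing.isLinear.Build _ _ _ _ f lf.
pose gL := GRing.isLinear.Build _ _ _ _ g lg.
pose f' : {scalar {malg F[K]}} := HB.pack f fL.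
pose g' : {scalar {malg F[K]}} := HB.pack g gL.
rewrite -[f u]/(f' u) -[g u]/(g' u) (monalgE u) !linear_sum.
apply: eq_bigr => k _.
have -> : << u@_k *g k >> = u@_k *: << k >> :> {malg F[K]}.
  by apply/malgP => j; rewrite mcoeffZ !mcoeffU mulrnAr mulr1.
by rewrite !linearZ /= fg.
Qed.

Lemma left_frobenius_basis (F : fieldType) (K : choiceType)
    (mul : {bilinear {malg F[K]} -> {malg F[K]} -> {malg F[K]}})
    (form : {biscalar {malg F[K]}}) :
    (forall a b c, form (mul << a >> << b >>) << c >>
                     = form << b >> (mul << a >> << c >>)) ->
  left_frobenius mul form.
Proof.
move=> frob x y z.
apply: (malg_scalar_ext (f := fun x => form (mul x y) z)
  (g := fun x => form y (mul x z))) => [k u v|k u v|a] /=.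
- by rewrite linearPl linearPl.
- by rewrite linearPl linearPr.
apply: (malg_scalar_ext (f := fun y => form (mul << a >> y) z)
  (g := fun y => form y (mul << a >> z))) => [k u v|k u v|b] /=.
- by rewrite linearPr linearPl.
- by rewrite linearPl.
apply: (malg_scalar_ext (f := fun z => form (mul << a >> << b >>) z)
  (g := fun z => form << b >> (mul << a >> z))) => [k u v|k u v|c] /=.
- by rewrite linearPr.
- by rewrite linearPr linearPr.
exact: frob.
Qed.

(** The hypothesis eta (p - 2) = -1 enters here: it makes the sum of the
coordinates of a * b equal to eta. *)
Lemma GM_form_mul p (G : groupType) (T : set G) (F : fieldType) (eta : F)
    (GMT : GM_type p T) (a b c : T) : odd p -> a != b ->
    eta * (p%:R - 2%:R) = -1 ->
  GM_form T eta (otg_basis_mul (GM_otg GMT) eta a b) << c >>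
    = eta ^+ 2 + (1 - eta) * ((1 - eta) * (conjT (GM_otg GMT) b a == c)%:R
        + eta * (c \in involT a b)%:R).
Proof.
move=> odd_p ab eta_p; rewrite otg_basis_mul_neq //.
rewrite linearDl 2!linearZl_LR /= GM_formE GM_form_sum (card_involT GMT odd_p ab).
rewrite in_fset_set; last exact: (finite_involT (GM_otg GMT)).
have -> : eta * p%:R = eta * 2%:R - 1.
  by rewrite -eta_p -mulrDr addrC subrK.
ring.
Qed.

Lemma involT_exchange p (G : groupType) (T : set G) (GMT : GM_type p T)
    (a b c : T) : prime p -> odd p -> a != b -> a != c ->
  (c \in involT a b) = (b \in involT a c).
Proof.
move=> pr_p odd_p.
have inv x : has_order (\val x) 2 := otg_involutions (GM_otg GMT) (set_valP x).
have exch x y : a != x -> a != y -> y \in involT a x -> x \in involT a y.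
  move=> ax ay; rewrite !inE; apply: (invol_in_exchange pr_p odd_p) => //.
    apply: (GM_order GMT); [exact: set_valP|exact: set_valP|].
    by apply/eqP; rewrite val_eqE.
  by apply/eqP; rewrite val_eqE eq_sym.
by move=> ab ac; apply/idP/idP; apply: exch.
Qed.

Theorem lemma31 (p : nat) (G : groupType) (T : set G) (F : fieldType) (eta : F)
    (p_prime : prime p) (p_odd : odd p) (GMT : GM_type p T)
    (char_not2 : 2%N \notin [pchar F]) (eta_neq0 : eta != 0) (eta_neq1 : eta != 1)
    (good : good_characteristic p eta) :
  eta = - (1 / (p%:R - 2%:R)) ->
  left_frobenius (otg_mul (GM_otg GMT) eta) (GM_form T eta).
Proof.
(* If p - 2 were 0 in F, the convention 1 / 0 = 0 would force eta = 0. *)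
move=> eta_def; have eta_p : eta * (p%:R - 2%:R) = -1.
  rewrite eta_def mulNr mul1r mulVf //; apply: contraNneq eta_neq0 => p2.
  by rewrite eta_def p2 invr0 mulr0 oppr0.
(* This value settles the two cases where a equals exactly one of b and c. *)
have form_idem a c : a != c ->
    GM_form T eta (otg_basis_mul (GM_otg GMT) eta a c) << a >> = eta.
  move=> ac; rewrite GM_form_mul //.
  have -> : a \in involT a c.
    by rewrite inE; apply/invol_in_left/(otg_involutions (GM_otg GMT))/set_valP.
  have -> : (conjT (GM_otg GMT) c a == a) = false.
    by rewrite conjT_swap conjTxx; apply: negbTE.
  by rewrite mulr0 add0r mulr1 mulrBl mul1r addrC subrK.
apply: left_frobenius_basis => a b c.
rewrite /otg_mul /= !bilin_extUU [RHS]GM_form_sym.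
have [<-|ab] := eqVneq a b; have [ac|ac] := eqVneq a c.
- by rewrite -ac.
- by rewrite form_idem // /otg_basis_mul eqxx GM_formxy.
- by rewrite -ac form_idem // /otg_basis_mul eqxx GM_formxy.
by rewrite !GM_form_mul // conjT_swap (involT_exchange GMT).
Qed.
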